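(* Let $(X,d)$ be a metric space of Assouad-Nagata dimension $n$. For every function $f:\mathbb{R}_+\to\mathbb{Z}_+$, the family of intersection graphs of $f$-space-filling systems of subsets of $X$ has asymptotic dimension at most $2n+1$.
   Context: For a collection $\mathcal{U}$ of subsets of a metric space $(X,d)$, the Lebesgue number $L(\mathcal{U})$ is the supremum of $r\ge 0$ such that every ball $B(x,r)$ is contained in some $U\in\mathcal{U}$, and $\mathrm{mesh}(\mathcal{U})$ is the supremum of diameters of elements of $\mathcal{U}$. A function $D:\mathbb{R}_+\to\mathbb{R}_+$ is an $m$-dimensional control function for $(X,d)$ if for every $r>0$ there is a cover $\mathcal{U}=\bigcup_{i=1}^{m+1}\mathcal{U}_i$ of $X$ with $\mathrm{mesh}(\mathcal{U})\le D(r)$, $L(\mathcal{U})\ge r$, and the elements of each $\mathcal{U}_i$ pairwise disjoint. The Assouad-Nagata dimension of $(X,d)$ is the minimum $m$ for which there is $K>1$ such that $D(r)=Kr$ is an $m$-dimensional control function. A system $\mathcal{S}$ of subsets of $X$ is $f$-space-filling if all its sets have finite diameter and for every $r,s>0$ and $x\in X$, the ball $B(x,r)$ is intersected by at most $f(r/s)$ pairwise-disjoint elements of $\mathcal{S}$ of diameter at least $s$. The intersection graph of $\mathcal{S}$ has vertex set $\mathcal{S}$, with two sets adjacent iff they intersect. A graph $G$ is viewed as the metric space $(V(G),d_G)$ with shortest-path distance. A class $\mathcal{G}$ of graphs has asymptotic dimension at most $m$ if some single function $D$ is an $m$-dimensional control function for every graph in $\mathcal{G}$. *)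

(* Defs.v *)
From mathcomp Require Import all_boot all_order all_algebra.
From mathcomp Require Import all_classical all_reals.
From mathcomp Require Import cardinality ereal metric_structure.

Set Implicit Arguments.
Unset Strict Implicit.
Unset Printing Implicit Defensive.

Import Order.TTheory GRing.Theory Num.Theory.

Local Open Scope classical_set_scope.
Local Open Scope ring_scope.

(* Distances take values in the extended reals, so that the same notions apply
   to a metric space and to the vertex set of a graph, where two vertices in
   different components are at distance +oo. *)
Section ExtendedDistance.
Context {R : realType} {T : Type} (d : T -> T -> \bar R).
Implicit Types (A : set T) (U : set (set T)).

Definition eball (x : T) (r : R) : set T := [set y | (d x y < r%:E)%E].

(* The maximum with 0 only matters for the empty set, which would otherwise
   get diameter -oo. *)
Definition diameter A : \bar R :=
  maxe 0%E (ereal_sup [set d p.1 p.2 | p in A `*` A]).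

Definition mesh U : \bar R := ereal_sup [set diameter A | A in U].

Definition lebesgue_number U : \bar R :=
  ereal_sup [set r%:E | r in
    [set r : R | 0 <= r /\ forall x, exists2 A, U A & eball x r `<=` A]].

Definition control_function (m : nat) (D : R -> R) : Prop :=
  (forall r, 0 <= r -> 0 <= D r) /\
  forall r, 0 < r -> exists U : 'I_m.+1 -> set (set T),
    let W := \bigcup_(i in [set: 'I_m.+1]) U i in
    [/\ cover W id = [set: T],
        (mesh W <= (D r)%:E)%E,
        (r%:E <= lebesgue_number W)%E &
        forall i, trivIset (U i) id].

End ExtendedDistance.

Section MetricSpace.
Context {R : realType} (X : metricType R).

Definition edist (x y : X) : \bar R := (mdist x y)%:E.

Definition AN_dim_le (m : nat) : Prop :=
  exists2 K : R, 1 < K & control_function edist m (fun r => K * r).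

Definition AN_dim (n : nat) : Prop :=
  AN_dim_le n /\ forall m, AN_dim_le m -> (n <= m)%N.

(* Only the values of f at positive reals matter. *)
Definition space_filling (f : R -> nat) (S : set (set X)) : Prop :=
  (forall A, S A -> (diameter edist A < +oo)%E) /\
  forall (r s : R) (x : X), 0 < r -> 0 < s ->
    forall P : set (set X), P `<=` S -> trivIset P id ->
      (forall A, P A ->
         (s%:E <= diameter edist A)%E /\ A `&` ball x r !=set0) ->
      (P #<= `I_(f (r / s)))%card.

End MetricSpace.

Record sgraph := SGraph {
  vertex :> Type;
  edge : rel vertex;
  edge_sym : symmetric edge;
  edge_irrefl : irreflexive edge
}.

Definition graph_dist {R : realType} (G : sgraph) (u v : G) : \bar R :=
  ereal_inf [set ((size p)%:R : R)%:E | p in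
    [set p : seq G | path (@edge G) u p /\ last u p = v]].

(* A class of graphs is a predicate rather than a [set], because the universe of
   [set] is too small for sets of graphs whose vertices form a [set_type]. *)
Definition asdim_le (R : realType) (C : sgraph -> Prop) (m : nat) : Prop :=
  exists D : R -> R, forall G, C G -> control_function (@graph_dist R G) m D.

Section IntersectionGraph.
Context {T : Type} (S : set (set T)).

Definition meets (A B : S) : bool :=
  `[< A <> B /\ val A `&` val B !=set0 >].

Lemma meets_sym : symmetric meets.
Proof.
by move=> A B; apply/asboolP/asboolP => -[AB]; rewrite setIC => ?;
  split=> // BA; apply: AB.
Qed.

Lemma meets_irrefl : irreflexive meets.
Proof. by move=> A; apply/asboolP => -[]. Qed.

Definition intersection_graph : sgraph := SGraph meets_sym meets_irrefl.

End IntersectionGraph.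

Definition space_filling_graphs {R : realType} (X : metricType R)
    (f : R -> nat) (G : sgraph) : Prop :=
  exists2 S : set (set X), space_filling f S & G = intersection_graph S.

(* Main.v *)
Require Import Defs.
From mathcomp Require Import all_boot all_order all_algebra.
From mathcomp Require Import all_classical all_reals.
From mathcomp Require Import cardinality ereal metric_structure.
From mathcomp Require Import zify ring lra.

(** Fix a step length [r]. It suffices to colour the vertices with [2 (n + 1)]
    colours so that monochromatic chains of steps of length at most [r] have
    bounded length in the graph, uniformly over all systems; by compactness one
    may assume that the system is finite.

    Give each set [v] the level [k] for which the largest diameter found within
    [r] steps of [v] is about [l ^ k], and an index [i <= n] such that a ball
    around [v] of radius much larger than [r l ^ k] lies in one element (the cell
    of [v]) of the [i]-th family of a cover of [X] at that scale. Paths of length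
    [r] starting at [v] only use small sets and do not leave the cell, so for
    fixed [i] an [r]-step between two vertices forces their cells to be equal or
    nested: the vertices of index [i] are decomposed along a forest of cells.
    Space-filling says that each bag of this decomposition is covered by boundedly
    many sets of bounded diameter.

    It remains to 2-colour graphs with a tree decomposition whose bags are covered
    by [N] cliques. Induct on [N]. Walking down the tree, start a new piece at a
    node as soon as its bag is far from the bag [Z] of the node where the current
    piece started. Within a piece every bag comes close to [Z], so deleting a
    neighbourhood of [Z] lowers [N]; the piece is coloured by induction at a larger
    scale, the neighbourhood of [Z] is bounded and gets one colour. Just below the
    node where a piece starts, colours are inherited from the piece above, and two
    thin shells, one of each colour, stop the components that come from above. *)

Set Implicit Arguments.
Unset Strict Implicit.
Unset Printing Implicit Defensive.

Import Order.TTheory GRing.Theory Num.Theory.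

(** * Paths and chains of bounded steps *)

Section Near.
Context {V : Type}.
Implicit Types (E : V -> V -> Prop) (P Z : V -> Prop) (x y z : V) (m n q : nat).

Fixpoint reach E n x y : Prop :=
  if n is m.+1 then reach E m x y \/ exists2 z, reach E m x z & E z y else x = y.

Definition subgraph E P x y := [/\ E x y, P x & P y].

Definition reach_set E n x Z := exists2 z, Z z & reach E n x z.

Inductive linked E P n x : V -> Prop :=
| linked0 : P x -> linked E P n x x
| linkedS y z : linked E P n x y -> reach E n y z -> P z -> linked E P n x z.

Definition clique_cover E N Z := exists2 c : V -> nat,
  forall z, Z z -> c z < N &
  forall z z', Z z -> Z z' -> c z = c z' -> reach E 1 z z'.

Lemma reach_refl E n x : reach E n x x.
Proof. by elim: n => //= n IH; left. Qed.

Lemma reach_leq E m n x y : m <= n -> reach E m x y -> reach E n x y.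
Proof.
move=> /subnKC <-; elim: (n - m) => [|k IH] h; first by rewrite addn0.
by rewrite addnS; left; apply: IH.
Qed.

Lemma reach1 E x y : E x y -> reach E 1 x y.
Proof. by move=> h; right; exists x. Qed.

Lemma reach_trans E m n x y z : reach E m x y -> reach E n y z -> reach E (m + n) x z.
Proof.
move=> xy; elim: n z => [|n IH] z /=; first by move=> <-; rewrite addn0.
rewrite addnS => -[/IH|[w /IH xw wz]]; first by left.
by right; exists w.
Qed.

Lemma reach_sym E : (forall x y, E x y -> E y x) ->
  forall n x y, reach E n x y -> reach E n y x.
Proof.
move=> sE; elim=> [|n IH] x y //= [/IH|[z /IH zx /sE zy]]; first by left.
by rewrite -/(reach E n.+1 y x) -add1n; apply: reach_trans zx; apply: reach1.
Qed.

Lemma reach_sub E E' n x y : (forall x y, E x y -> E' x y) ->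
  reach E n x y -> reach E' n x y.
Proof.
move=> EE'; elim: n y => [|n IH] y //= [/IH|[z /IH xz /EE' zy]]; first by left.
by right; exists z.
Qed.

(** A path that leaves [P] is stopped at its first vertex outside [P]. *)
Lemma reach_subgraph E P n x y : P x -> reach E n x y ->
  reach (subgraph E P) n x y \/ exists z, [/\ ~ P z, reach E n x z & reach E n z y].
Proof.
move=> Px; elim: n y => [|n IH] y /=; first by left.
move=> [xy|[w xw wy]].
  have [|[z [Pz xz zy]]] := IH _ xy; first by left; left.
  by right; exists z; split=> //; left.
have [xw'|[z [Pz xz zw]]] := IH _ xw; last first.
  by right; exists z; split=> //; [left|right; exists w].
have [Py|Py] := pselect (P y).
  left; right; exists w => //; split=> //.
  move: xw'; case: n {IH xw} => [<- //|n] /=.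
  elim: n w {wy} => [|n IHn] w /=.
    by case=> [<- //|[? _ []]].
  by case=> [/IHn|[? _ []]].
right; exists y; split=> //; first by right; exists w.
exact: (@reach_refl _ n.+1).
Qed.

Lemma reach_expand E E' m n x y : (forall x y, E x y -> reach E' m x y) ->
  reach E n x y -> reach E' (n * m) x y.
Proof.
move=> EE'; elim: n y => [//|n IH] y /= [/IH|[z /IH xz /EE' zy]].
  by apply: reach_leq; rewrite mulSn leq_addl.
by rewrite mulSn addnC; apply: reach_trans zy.
Qed.

Lemma linked_source E P n x y : linked E P n x y -> P x.
Proof. by elim. Qed.

Lemma linked_target E P n x y : linked E P n x y -> P y.
Proof. by case. Qed.

Lemma linked_trans E P n x y z :
  linked E P n x y -> linked E P n y z -> linked E P n x z.
Proof.
by move=> xy; elim=> // v w _ xv vw; apply: linkedS vw.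
Qed.

Lemma linked_sym E P n x y : (forall x y, E x y -> E y x) ->
  linked E P n x y -> linked E P n y x.
Proof.
move=> sE; elim=> [Px|v z xy yx yz Pz]; first exact: linked0.
apply: linked_trans yx; apply: (linkedS (linked0 _ _ Pz)).
- exact: reach_sym.
- exact: linked_target xy.
Qed.


Lemma linked_map E E' P P' m n x y : (forall x, P x -> P' x) ->
  (forall x y, P x -> P y -> reach E m x y -> reach E' n x y) ->
  linked E P m x y -> linked E' P' n x y.
Proof.
move=> PP' EE'; elim=> [/PP'|v w xv IH vw Pw]; first exact: linked0.
by apply: (linkedS IH _ (PP' _ Pw)); apply: EE' => //; apply: linked_target xv.
Qed.

Lemma linked_linked E P n x y :
  linked E P n x y -> linked E (linked E P n x) n x y.
Proof.
elim=> [Px|v w xv IH vw Pw]; first by do 2!apply: linked0.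
exact: (linkedS IH vw (linkedS xv vw Pw)).
Qed.

(** The bound of [linked_cover]: a walk to the neighbourhood of the last clique, a crossing of it
    and a walk back, where the walks use one clique fewer. *)
Fixpoint spread N q n := if N is m.+1 then
  (spread m q n + n + (q + 1 + q) + (spread m q n + n))%N else 0.


(** Induction on the number of cliques. A chain avoiding the [q]-neighbourhood of the last clique
    needs one clique fewer. Otherwise follow it from both ends up to its first visit to that
    neighbourhood, whose points are pairwise within [q + 1 + q]. *)
Lemma linked_cover E N Z q n P x y : (forall x y, E x y -> E y x) ->
  clique_cover E N Z -> (forall x, P x -> reach_set E q x Z) ->
  linked E P n x y -> reach E (spread N q n) x y.
Proof.
move=> sE; elim: N Z P x y => [|N IH] Z P x y [c cN cE] PZ xy.
  by have [z /cN] := PZ _ (linked_source xy).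
pose A p := exists z, [/\ Z z, c z = N & reach E q p z].
have AA p p' : A p -> A p' -> reach E (q + 1 + q) p p'.
  move=> [z [Zz cz pz]] [z' [Zz' cz' pz']].
  apply: reach_trans (reach_sym sE pz').
  by apply: reach_trans pz _; apply: cE; rewrite // cz.
pose PA p := P p /\ ~ A p.
have IHA u v : linked E PA n u v -> reach E (spread N q n) u v.
  apply: (IH (fun z => Z z /\ c z <> N)).
    exists c => [z [/cN + /eqP]|z z' [Zz _] [Zz' _]]; last exact: cE.
    by rewrite ltnS leq_eqVlt => /orP[->|].
  move=> p [/PZ[z Zz pz] Ap]; exists z => //; split=> // cz.
  by apply: Ap; exists z.
have key u v : linked E P n u v -> linked E PA n u v \/
    exists2 a, A a & reach E (spread N q n + n) u a.
  elim=> [Pu|{}v w _ [uv|T] vw Pw]; last by right.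
    have [Au|Au] := pselect (A u); last by left; apply: linked0.
    by right; exists u => //; apply: reach_refl.
  have [Aw|Aw] := pselect (A w); last by left; apply: linkedS vw _.
  by right; exists w => //; apply: reach_trans vw; apply: IHA.
have [/IHA|[a Aa xa]] := key _ _ xy.
  by apply: reach_leq => /=; lia.
have [/IHA /(reach_sym sE)|[b Ab yb]] := key _ _ (linked_sym sE xy).
  by apply: reach_leq => /=; lia.
rewrite /=; apply: reach_trans (reach_sym sE yb).
by apply: reach_trans xa _; apply: AA.
Qed.

End Near.

(** * Graphs decomposed along a tree *)

Section Suffix.
Context {A : eqType}.
Implicit Types (a : A) (s b c h : seq A).

Lemma suffix_cons_split b a s : suffix b (a :: s) = (b == a :: s) || suffix b s.
Proof.
apply/idP/orP => [/suffixP[[|x t] /= e]|[/eqP->|]].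
- by left; rewrite e.
- by case: e => _ ->; right; exact: suffix_suffix.
- exact: suffix_refl.
- by move=> /suffixP[t ->]; rewrite -cat_cons suffix_suffix.
Qed.

Lemma suffix_anti b c : suffix b c -> suffix c b -> b = c.
Proof.
move=> /suffixP[s ->] /size_suffix; rewrite size_cat.
by case: s => //= x s; lia.
Qed.

Lemma suffix_comparable b c h : suffix b h -> suffix c h -> suffix b c || suffix c b.
Proof.
elim: h => [|a h IH]; first by rewrite !suffixs0 => /eqP-> /eqP->.
rewrite !suffix_cons_split => /orP[/eqP->|bh] /orP[/eqP->|ch].
- by rewrite suffix_refl.
- by rewrite suffix_cons_split ch !orbT.
- by rewrite suffix_cons_split bh orbT.
- exact: IH.
Qed.

Lemma suffix_behead b h : suffix b h -> b <> h -> suffix b (behead h).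
Proof. by case: h => [|a h]; [rewrite suffixs0 => /eqP| rewrite suffix_cons_split => /orP[/eqP|]]. Qed.

End Suffix.

Section TreeLike.
(* The nodes of the tree are lists and the ancestors of a node are its suffixes.
   Only the vertices in [V'] have to be coloured; the others are kept because
   paths through them matter for distances. *)
Context {V : Type} {A : eqType}.
Variables (E : V -> V -> Prop) (V' : V -> Prop) (home : V -> seq A).

(** The adhesion set between the subtree at [b] and the rest of the tree decomposition. *)
Definition up_bag (b : seq A) (z : V) := exists x,
  [/\ E x z, suffix b (home x), suffix (home z) b & home z <> b].

Definition bag_at b z := up_bag b z \/ V' z /\ home z = b.

Record treelike (N : nat) : Prop := {
  treelike_sym : forall x y, E x y -> E y x;
  treelike_comparable : forall x z, E x z ->
    suffix (home z) (home x) || suffix (home x) (home z);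
  treelike_coloured : forall x z, E x z ->
    suffix (home z) (home x) -> home z <> home x -> V' z;
  treelike_cover : forall b, clique_cover E N (bag_at b) }.

End TreeLike.

(** * One induction step: cutting the tree into pieces and gluing their colourings *)

Section Step.
Context {V : Type} {A : eqType} (N n t : nat).
Context (E : V -> V -> Prop) (V' : V -> Prop) (home : V -> seq A).
Hypothesis G : treelike E V' home N.+1.

Local Notation R := (5 * n).
Local Notation up := (up_bag E home).
Local Notation bag := (bag_at E V' home).
Implicit Types (b c h s : seq A) (x y z v : V).

Let sE := treelike_sym G.

Lemma up_sub_bag b z : up b z -> bag b z. Proof. by left. Qed.


Lemma up_coloured b z : up b z -> V' z.
Proof.
move=> [x [xz bx zb nzb]]; apply: (treelike_coloured G xz).
  exact: suffix_trans zb bx.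
by move=> e; apply: nzb; apply: suffix_anti => //; rewrite e.
Qed.

(** Take the first vertex outside the subtree of [b]: its home is comparable with that of its
    predecessor, hence lies strictly above [b]. *)
Lemma crossing m b x y : reach E m x y -> suffix b (home x) ->
  ~~ suffix b (home y) -> exists z, [/\ up b z, reach E m x z & reach E m z y].
Proof.
move=> + bx; elim: m y => [|m IH] y /=; first by move=> <-; rewrite bx.
move=> [/IH h /h[z [bz xz zy]]|[w xw wy] nby].
  by exists z; split=> //; left.
have [bw|/(IH _ xw)[z [bz xz zw]]] := boolP (suffix b (home w)); last first.
  by exists z; split=> //; [left|right; exists w].
exists y; split; [|by right; exists w|exact: (reach_refl _ m.+1)].
exists w; have /orP[yw|wy'] := treelike_comparable G wy; last first.
  by case/negP: nby; apply: suffix_trans wy'.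
have /orP[by'|yb] := suffix_comparable bw yw; first by rewrite by' in nby.
by split=> // e; rewrite e suffix_refl in nby.
Qed.

(* [cut h] is the node at which the piece containing [h] starts. *)
Fixpoint cut h := if h is a :: s then
  if `[< forall z, bag h z -> ~ reach_set E R z (bag (cut s)) >] then h else cut s
  else [::].

Lemma cut_suffix h : suffix (cut h) h.
Proof.
elim: h => //= a s IH; case: ifP => _; first exact: suffix_refl.
by rewrite suffix_cons_split IH orbT.
Qed.

(** With [cut_idem], this makes [cut h] the lowest fixed point of [cut] among the ancestors of
    [h]. *)
Lemma cut_mono b h : suffix b h -> cut b = b -> suffix b (cut h).
Proof.
elim: h => [|a s IH]; first by rewrite suffixs0 => /eqP->.
rewrite suffix_cons_split => /orP[/eqP-> ->|bs cb]; first exact: suffix_refl.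
move=> /=; case: ifP => _; last exact: IH.
by rewrite suffix_cons_split bs orbT.
Qed.

Lemma cut_idem h : cut (cut h) = cut h.
Proof. by elim: h => //= a s IH; case: ifP => //= ->. Qed.

Lemma cut_between c b h : suffix c b -> suffix b h -> cut h = c -> cut b = c.
Proof.
move=> cb bh e; have cc : cut c = c by rewrite -e cut_idem.
apply: suffix_anti; last exact: cut_mono.
by rewrite -e; apply: cut_mono (cut_idem _); apply: suffix_trans bh; apply: cut_suffix.
Qed.

Lemma cut_far b z z' : b <> [::] -> cut b = b ->
  bag b z -> bag (cut (behead b)) z' -> ~ reach E R z z'.
Proof.
case: b => // a s _ /=; case: ifP => [/asboolP h _ bz cz zz'|_ e].
  by apply: (h z bz); exists z'.
by have := size_suffix (cut_suffix s); rewrite e /= ltnn.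
Qed.

Lemma not_cut_reach b c : cut b = c -> b <> c ->
  exists2 z, bag b z & reach_set E R z (bag c).
Proof.
case: b => [|a s] /=; first by move=> <-.
case: ifP => [_ -> //|/negbT/asboolPn h <- _].
apply: contrapT => nh; apply: h => z bz zc; apply: nh; by exists z.
Qed.

(* [pi c h] is the longest suffix of [h] belonging to the piece of [c]. *)
Fixpoint pi c h := if h is a :: s then if cut h == c then h else pi c s else [::].

Lemma pi_suffix c h : suffix (pi c h) h.
Proof.
elim: h => //= a s IH; case: ifP => _; first exact: suffix_refl.
by rewrite suffix_cons_split IH orbT.
Qed.

Lemma pi_id c h : cut h = c -> pi c h = h.
Proof. by case: h => //= a s ->; rewrite eqxx. Qed.

Lemma pi_max c b h : suffix b h -> cut b = c -> suffix b (pi c h).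
Proof.
elim: h => [|a s IH]; first by rewrite suffixs0 => /eqP->.
rewrite suffix_cons_split => /orP[/eqP-> /pi_id ->|bs cb]; first exact: suffix_refl.
rewrite [pi c _]/=; case: ifP => _; last exact: IH.
by rewrite suffix_cons_split bs orbT.
Qed.

Lemma cut_pi c h : cut c = c -> suffix c h -> cut (pi c h) = c.
Proof.
move=> cc; elim: h => [|a s IH]; first by rewrite suffixs0 => /eqP->.
rewrite suffix_cons_split => /orP[/eqP e|/IH IHs]; first by rewrite -e pi_id.
by rewrite [pi c _]/=; case: ifP => // /eqP.
Qed.

Definition removed c v := reach_set E R.+1 v (bag c).
(** Vertices of lower pieces are kept, since paths through them count for distances; only those in
    [piece] are coloured. *)
Definition kept c v := suffix c (home v) /\ ~ removed c v.
Definition piece c v := [/\ V' v, cut (home v) = c & ~ removed c v].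

Local Notation E' c := (subgraph E (kept c)).
Local Notation home' c := (fun v => pi c (home v)).

(** Truncating homes to the piece leaves the adhesion sets inside the old ones, so the cliques of
    the old bags can be reused. *)
Lemma piece_up c x z b : cut c = c -> E' c x z ->
  suffix b (pi c (home x)) -> suffix (pi c (home z)) b -> pi c (home z) <> b ->
  [/\ cut b = c, up b z & piece c z].
Proof.
move=> cc [xz [cx nrx] [cz nrz]] bx zb nzb.
have czb : suffix c b by apply: suffix_trans zb; apply: pi_max.
have cb : cut b = c by apply: cut_between bx (cut_pi cc cx).
have bx' : suffix b (home x) by apply: suffix_trans bx (pi_suffix _ _).
have nbz : ~ suffix b (home z).
  by move=> bz; apply: nzb; apply: suffix_anti zb _; apply: pi_max.
have zb' : suffix (home z) b.
  have /orP[zx|xz'] := treelike_comparable G xz.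
    by have /orP[] := suffix_comparable zx bx'.
  by case: nbz; apply: suffix_trans xz'.
have hz : cut (home z) = c by apply: cut_between zb' cb.
have uz : up b z.
  by exists x; split=> // e; apply: nbz; rewrite e suffix_refl.
by split=> //; split=> //; exact: up_coloured uz.
Qed.

Lemma piece_kept c z : piece c z -> kept c z.
Proof. by move=> [_ <- nz]; split=> //; apply: cut_suffix. Qed.

Lemma bag_piece c b z : cut c = c -> bag_at (E' c) (piece c) (home' c) b z ->
  [/\ cut b = c, bag b z & piece c z].
Proof.
move=> cc [[x [xz bx zb nzb]]|[[Vz cz nz] e]].
  by have [cb uz pz] := piece_up cc xz bx zb nzb; split=> //; left.
have e' : home z = b by rewrite -e pi_id.
by split=> //; [rewrite -e'|right].
Qed.

(** The bag of a node of the piece other than [c] has a vertex within [R] of the bag of [c]. The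
    whole clique of that vertex is within [R + 1], so it is removed and one clique is saved. The bag
    of [c] itself is emptied. *)
Lemma treelike_piece c : cut c = c -> treelike (E' c) (piece c) (home' c) N.
Proof.
move=> cc; split.
- by move=> x y [/sE ? ? ?].
- move=> x z [xz _ _].
  have /orP[h|h] := treelike_comparable G xz.
    exact: suffix_comparable (suffix_trans (pi_suffix _ _) h) (pi_suffix _ _).
  exact: suffix_comparable (pi_suffix _ _) (suffix_trans (pi_suffix _ _) h).
- move=> x z xz zx nzx.
  by have [] := piece_up cc xz (suffix_refl _) zx nzx.
- move=> b; have [nb|ne] := pselect (forall z, ~ bag_at (E' c) (piece c) (home' c) b z).
    by exists (fun=> 0) => [z|z z'] /nb.
  have [cb nbc] : cut b = c /\ b <> c.
    have [z bz] : exists z, bag_at (E' c) (piece c) (home' c) b z.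
      by apply: contrapT => h; apply: ne => z bz; apply: h; exists z.
    have [cb bz' [_ _ nz]] := bag_piece cc bz; split=> // e.
    by apply: nz; exists z; [rewrite -e|exact: reach_refl].
  have [z0 bz0 [w cw z0w]] := not_cut_reach cb nbc.
  have [f fN fE] := treelike_cover G b.
  have fz0 z : bag_at (E' c) (piece c) (home' c) b z -> f z <> f z0.
    move=> /(bag_piece cc)[_ bz [_ _ nz]] e; apply: nz; exists w => //.
    by rewrite -add1n; apply: reach_trans z0w; apply: fE.
  (* The value [f z0] is free after the removal, so the clique numbered [N] takes it over. *)
  exists (fun z => if f z == N then f z0 else f z) => [z bz|z z' bz bz' e].
    have [_ bz1 _] := bag_piece cc bz; have := fN _ bz1; have := fN _ bz0.
    have := fz0 z bz; case: eqP; lia.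
  have [_ bz1 pz] := bag_piece cc bz; have [_ bz1' pz'] := bag_piece cc bz'.
  have /(fE _ _ bz1 bz1') : f z = f z'.
    move: e (fz0 _ bz) (fz0 _ bz'); case: eqP => [->|_]; case: eqP => [->|_] //.
    by move=> ->.
  move=> [zz'|[v zv vz']]; first by left.
  by right; exists v => //; rewrite -zv in vz' *; split=> //; exact: piece_kept.
Qed.

(* [col c] is a colouring of the piece of [c], given by the induction. *)
Variable (D' : nat) (col : seq A -> V -> bool).
Hypothesis colP : forall c, cut c = c -> forall x y k,
  linked (E' c) (fun v => piece c v /\ col c v = k) t x y ->
  reach (E' c) D' x y.

(** The constant [false] near the starting bag is also the shell that stops chains of colour
    [true]. *)
Definition core v :=
  let c := cut (home v) in if `[< removed c v >] then false else col c v.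

Definition zone c k v := [/\ V' v, cut (home v) = c & core v = k].

Local Notation Q := (R.+1 + t).
Definition core_bound := D' + spread N.+1 (D' + Q) t.

(** A chain that stays away from the bag of [c] is a chain of the piece, bounded by [D']. Otherwise
    every point of its component is within [D' + Q] of that bag, and [linked_cover] applies. *)
Lemma linked_core c k x y : linked E (zone c k) t x y -> reach E core_bound x y.
Proof.
move=> xy; have cc : cut c = c by case: (linked_source xy) => _ <- _; exact: cut_idem.
pose K v := piece c v /\ col c v = k.
have EE' u v : E' c u v -> E u v by case.
have zoneK v : zone c k v -> ~ removed c v -> K v.
  move=> [Vv hv]; rewrite /core hv; case: asboolP => // nv <- _; by split.
have far_reach m u v : removed c u -> reach E m u v -> reach_set E (R.+1 + m) v (bag c).
  move=> [z cz uz] uv; exists z => //.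
  by rewrite addnC; apply: reach_trans uz; apply: reach_sym.
(* A step that is not one of the kept graph meets a removed vertex or leaves the subtree of [c]
   through its adhesion set; both ends are then close to the bag of [c]. *)
have near_or_step u v : zone c k u -> zone c k v -> reach E t u v ->
    (reach_set E Q u (bag c) /\ reach_set E Q v (bag c)) \/
    [/\ K u, K v & reach (E' c) t u v].
  move=> zu zv uv.
  have [ru|nu] := pselect (removed c u).
    left; split; last exact: far_reach uv.
    by case: ru => z cz uz; exists z => //; apply: reach_leq uz; lia.
  have [rv|nv] := pselect (removed c v).
    left; split; first by apply: far_reach (reach_sym sE uv).
    by case: rv => z cz vz; exists z => //; apply: reach_leq vz; lia.
  have [Ku Kv] := (zoneK _ zu nu, zoneK _ zv nv).
  have cu : suffix c (home u) by case: Ku => /piece_kept[].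
  have cv : suffix c (home v) by case: Kv => /piece_kept[].
  have [|uv'|[z [nz uz zv']]] := @reach_subgraph _ E (kept c) _ _ _ _ uv.
  - by split.
  - by right.
  have [cz|ncz] := boolP (suffix c (home z)).
    have rz : removed c z by apply: contrapT => nrz; apply: nz.
    by left; split; [apply: far_reach (reach_sym sE uz)|apply: far_reach zv'].
  have [w [cw uw wz]] := crossing uz cu ncz.
  have [w' [cw' vw' _]] := crossing (reach_sym sE zv') cv ncz.
  left; split; [exists w|exists w'] => //.
  - exact: up_sub_bag.
  - by apply: reach_leq uw; lia.
  - exact: up_sub_bag.
  - by apply: reach_leq vw'; lia.
have key u v : linked E (zone c k) t u v -> linked (E' c) K t u v \/
    exists w, [/\ linked E (zone c k) t u w, reach E D' u w &
                  reach_set E Q w (bag c)].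
  elim=> [zu|{}v w uv [uv'|T] vw zw]; last by right.
    have [ru|/(zoneK _ zu)] := pselect (removed c u); last by left; apply: linked0.
    right; exists u; split; [exact: linked0|exact: reach_refl|].
    by case: ru => z cz uz; exists z => //; apply: reach_leq uz; lia.
  have zv := linked_target uv.
  have [[rv _]|[Kv Kw vw']] := near_or_step _ _ zv zw vw.
    right; exists v; split=> //.
    by apply: (reach_sub EE'); apply: colP uv'.
  by left; apply: linkedS vw' _.
have [xy'|[w [xw _ [z cz wz]]]] := key _ _ xy.
  by apply: (reach_leq (leq_addr _ _)); apply: (reach_sub EE'); apply: colP xy'.
apply: (reach_leq (leq_addl _ _)).
apply: (linked_cover sE (treelike_cover G c) _ (linked_linked xy)) => v xv.
have vw : linked E (zone c k) t v w := linked_trans (linked_sym sE xv) xw.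
have [vw'|[w' [_ vw' [z' cz' wz']]]] := key _ _ vw.
  exists z => //; apply: reach_trans wz.
  by apply: (reach_sub EE'); apply: colP vw'.
by exists z' => //; apply: reach_trans wz'.
Qed.

(** * Gluing the colourings of the pieces *)

Local Notation T := (spread N.+1 (2 * n) n).
Hypothesis tT : T + 3 * n <= t.

Definition near_up m v := reach_set E m v (up (cut (home v))).

Variable shadow : V -> V.
Hypothesis shadowP : forall v, near_up n v ->
  up (cut (home v)) (shadow v) /\ reach E n v (shadow v).

(** Going down from the top of a piece: a strip with inherited colours, a shell of colour [true] up
    to distance [2 * n], then the core, which begins with [false]. *)
Definition colour v :=
  if `[< near_up n v >] then core (shadow v)
  else if `[< near_up (2 * n) v >] then true else core v.

Local Notation parent v := (cut (behead (cut (home v)))).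

Lemma near_up_leq m m' v : m <= m' -> near_up m v -> near_up m' v.
Proof. by move=> mm [z uz vz]; exists z => //; apply: reach_leq vz. Qed.

Lemma near_up_nonroot m v : near_up m v -> cut (home v) <> [::].
Proof. by move=> [z uz _] e; case: uz => x [_ _]; rewrite e suffixs0 => /eqP. Qed.

(** Starting bags of a piece and its parent are more than [R] apart. The largest sum used is
    [2 * n + n + 2 * n], in [adjacent_comparable]; it accounts for [R = 5 * n]. *)
Lemma near_up_far v w m1 m2 m3 : near_up m1 v -> reach_set E m2 w (up (parent v)) ->
  reach E m3 v w -> ~ m1 + m3 + m2 <= R.
Proof.
move=> uv [z uz wz] vw le; have b0 := near_up_nonroot uv.
case: uv => y uy vy; apply: (cut_far b0 (cut_idem _) (up_sub_bag uy) (up_sub_bag uz)).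
apply: reach_leq le _; apply: reach_trans wz.
exact: reach_trans (reach_sym sE vy) vw.
Qed.

Lemma escape v w : near_up (2 * n) v -> reach E n v w -> suffix (parent v) (home w).
Proof.
move=> uv vw; apply: contrapT => /negP nw.
have pv : suffix (parent v) (home v).
  apply: suffix_trans (cut_suffix (home v)); apply: suffix_trans (cut_suffix _) _.
  by case: (cut (home v)) => //= a s; exact: suffix_cons.
have [z [uz vz _]] := crossing vw pv nw.
by apply: (@near_up_far v v _ n 0 uv) => //; [exists z|lia].
Qed.

Lemma near_up_below v w : reach E n v w -> ~~ suffix (cut (home v)) (home w) ->
  near_up n v.
Proof.
by move=> vw nw; have [z [uz vz _]] := crossing vw (cut_suffix _) nw; exists z.
Qed.

Lemma suffix_parent b v : cut b = b -> suffix b (cut (home v)) ->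
  b <> cut (home v) -> suffix b (parent v).
Proof. by move=> cb bv nb; apply: cut_mono => //; apply: suffix_behead. Qed.

Lemma adjacent_inner v w : reach E n v w -> ~ near_up n v -> ~ near_up n w ->
  cut (home v) = cut (home w).
Proof.
move=> vw nv nw; apply: suffix_anti; apply: cut_mono (cut_idem _);
  apply: contrapT => /negP h.
- by apply: nv; apply: near_up_below vw h.
- by apply: nw; apply: near_up_below h; apply: reach_sym.
Qed.

(** A step from outside the strip stays in the subtree of its piece, so the piece of [w] is below
    that of [v]; [escape] leaves room for one level only. *)
Lemma adjacent_outer v w : reach E n v w -> ~ near_up n v -> near_up (2 * n) w ->
  cut (home v) <> cut (home w) -> near_up n w /\ cut (home v) = parent w.
Proof.
move=> vw nv nw ne; have wv := reach_sym sE vw.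
have vw' : suffix (cut (home v)) (home w).
  by apply: contrapT => /negP h; apply: nv; apply: near_up_below vw h.
have vcw := cut_mono vw' (cut_idem _); split.
  apply: near_up_below wv _; apply/negP => h; apply: ne.
  by apply: suffix_anti vcw _; apply: cut_mono h (cut_idem _).
apply: suffix_anti; first by apply: suffix_parent => //; apply: cut_idem.
by apply: cut_mono (cut_idem _); apply: escape.
Qed.

Lemma adjacent_comparable v w : reach E n v w ->
  near_up (2 * n) v -> near_up (2 * n) w ->
  suffix (cut (home v)) (home w) -> cut (home v) = cut (home w).
Proof.
move=> vw uv uw h; apply: contrapT => ne; have wv := reach_sym sE vw.
have pv : cut (home v) = parent w.
  apply: suffix_anti; last by apply: cut_mono (cut_idem _); apply: escape.
  by apply: suffix_parent (cut_idem _) (cut_mono h (cut_idem _)) ne.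
apply: (@near_up_far w v _ (2 * n) n uw) => //; first by rewrite -pv.
by lia.
Qed.

(** By [adjacent_comparable] the step leaves both subtrees, while [escape] keeps it below both
    parents. *)
Lemma adjacent_siblings v w : reach E n v w ->
  near_up (2 * n) v -> near_up (2 * n) w -> cut (home v) <> cut (home w) ->
  [/\ near_up n v, near_up n w & parent v = parent w].
Proof.
move=> vw uv uw ne; have wv := reach_sym sE vw.
have nvw : ~~ suffix (cut (home v)) (home w).
  by apply/negP => /(adjacent_comparable vw uv uw).
have nwv : ~~ suffix (cut (home w)) (home v).
  by apply/negP => /(adjacent_comparable wv uw uv)/esym.
have aux x y : reach E n x y -> near_up (2 * n) x ->
    ~~ suffix (cut (home y)) (home x) -> suffix (parent x) (parent y).
  move=> xy ux nyx; apply: suffix_parent (cut_idem _) _ _.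
    by apply: cut_mono (cut_idem _); apply: escape.
  move=> e; case/negP: nyx; rewrite -e; apply: suffix_trans (cut_suffix _).
  apply: suffix_trans (cut_suffix _) _.
  by case: (cut (home x)) => //= a s; exact: suffix_cons.
split; [exact: near_up_below vw _|exact: near_up_below wv _|].
by apply: suffix_anti; apply: aux.
Qed.

(* A vertex close to the bag above its piece is charged to that upper piece, in
   which it is represented by [shade v]; vertices of [shell] separate the two
   pieces and have no representative. *)
Definition owner v :=
  if `[< near_up n v >] then parent v else cut (home v).

Definition shade v := if `[< near_up n v >] then shadow v else v.

Definition shell v := near_up (2 * n) v /\ ~ near_up n v.

Lemma reach_shade v : reach E n v (shade v).
Proof.
rewrite /shade; case: asboolP => [/shadowP[]//|_]; exact: reach_refl.
Qed.

Lemma colour_shell v : shell v -> colour v = true.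
Proof. by move=> [h1 h2]; rewrite /colour; case: asboolP => // _; case: asboolP. Qed.

(** If the shadow had its home strictly above the start of the parent piece, it would lie in both
    adhesion sets, against [cut_far]. *)
Lemma cut_shadow v : near_up n v -> cut (home (shadow v)) = parent v.
Proof.
move=> uv; have [uz _] := shadowP uv; have b0 := near_up_nonroot uv.
have [x [xz bx zb nzb]] := uz.
have zs := suffix_behead zb nzb.
have /orP[pz|zp] := suffix_comparable (cut_suffix (behead (cut (home v)))) zs.
  exact: cut_between pz zs _.
have [<-|nzp] := pselect (parent v = home (shadow v)); first exact: cut_idem.
have upz : up (parent v) (shadow v).
  exists x; split=> // [|e]; last exact: nzp.
  apply: suffix_trans bx; apply: suffix_trans (cut_suffix _) _.
  by case: (cut (home v)) => //= a s; exact: suffix_cons.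
have [] := cut_far b0 (cut_idem _) (up_sub_bag uz) (up_sub_bag upz).
exact: reach_refl.
Qed.

Lemma zone_shade k v : V' v -> colour v = k -> ~ shell v -> zone (owner v) k (shade v).
Proof.
rewrite /colour /owner /shade => Vv; case: asboolP => [uv cv _|nv].
  have [uz _] := shadowP uv.
  by split=> //; [exact: up_coloured uz|exact: cut_shadow].
by case: asboolP => [u2 _ []|_ cv _]; [split|].
Qed.

Lemma near_up_shift m v w : cut (home v) = cut (home w) -> reach E n v w ->
  near_up m v -> near_up (n + m) w.
Proof.
rewrite /near_up => <- vw [z uz vz]; exists z => //.
exact: reach_trans (reach_sym sE vw) vz.
Qed.

(** Inside a piece, one step cannot jump over the shell. Between pieces, it joins two strips with a
    common parent, or a strip to its parent. *)
Lemma owner_eq v w : reach E n v w -> ~ shell v -> ~ shell w -> owner v = owner w.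
Proof.
move=> vw; have wv := reach_sym sE vw.
have outer x : near_up n x -> near_up (2 * n) x by apply: near_up_leq; lia.
rewrite /owner /shell; case: asboolP => uv; case: asboolP => uw nv nw.
- have [-> //|ne] := pselect (cut (home v) = cut (home w)).
  by have [] := adjacent_siblings vw (outer _ uv) (outer _ uw) ne.
- have [e|/nesym ne] := pselect (cut (home v) = cut (home w)).
    by case: nw; split=> //; have := near_up_shift e vw uv; rewrite addnn -mul2n.
  by have [] := adjacent_outer wv uw (outer _ uv) ne.
- have [e|ne] := pselect (cut (home v) = cut (home w)).
    by case: nv; split=> //; have := near_up_shift (esym e) wv uw; rewrite addnn -mul2n.
  by have [] := adjacent_outer vw uv (outer _ uw) ne.
- exact: adjacent_inner.
Qed.

(** Just beyond the shell, vertices are within [3 * n] of the starting bag, hence removed and of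
    colour [false]. *)
Lemma shell_adjacent v w : reach E n v w -> shell w -> colour v = true ->
  cut (home v) = cut (home w) /\ near_up (2 * n) v.
Proof.
move=> vw [u2 u1] cv.
have [uv|nv] := pselect (near_up (2 * n) v).
  split=> //; apply: contrapT => ne.
  by have [] := adjacent_siblings vw uv u2 ne.
have nv1 : ~ near_up n v by move=> h; apply: nv; apply: near_up_leq h; lia.
have e : cut (home v) = cut (home w).
  by apply: contrapT => ne; have [] := adjacent_outer vw nv1 u2 ne.
have := near_up_shift (esym e) (reach_sym sE vw) u2.
move: cv; rewrite /colour; case: asboolP => // _; case: asboolP => // _.
rewrite /core; case: asboolP => // nr _ [z uz vz]; case: nr.
by exists z; [exact: up_sub_bag|apply: reach_leq vz; lia].
Qed.

Definition collar b v := cut (home v) = b /\ near_up (2 * n) v.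

Lemma linked_collar b v w : linked E (collar b) n v w -> reach E T v w.
Proof.
move=> vw; apply: (linked_cover sE (treelike_cover G b) _ vw) => x [<- [z uz xz]].
by exists z => //; apply: up_sub_bag.
Qed.

Definition step_bound := T + n + core_bound + (T + n).

(** Shades turn the chain into a [t]-chain in one zone. An excursion into a shell stays in one
    collar, so it spans at most [T] and returns to the same owner; [t] absorbs it. Starting or
    ending in a shell costs [T + n] at that end. *)
Lemma linked_colour k x y : linked E (fun v => V' v /\ colour v = k) n x y ->
  reach E step_bound x y.
Proof.
have shell_true v : colour v = k -> shell v -> k = true by move=> <- /colour_shell.
(* In the second case [y1] is the last vertex before the current shell, and its shadow holds the
   place in the zone. *)
pose rel c y y0 := [/\ ~ shell y, shade y = y0 & owner y = c] \/
  (shell y /\ exists b y1, [/\ near_up n y1, owner y1 = c,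
     linked E (collar b) n y1 y & shadow y1 = y0]).
have key : linked E (fun v => V' v /\ colour v = k) n x y ->
    (shell y /\ exists b, linked E (collar b) n x y) \/
    exists c x0 y0, [/\ linked E (zone c k) t x0 y0, reach E (T + n) x x0 & rel c y y0].
  elim=> [[Vx cx]|{}y z xy IH yz [Vz cz]].
    have [sx|nx] := pselect (shell x).
      left; split=> //; exists (cut (home x)); apply: linked0.
      by case: sx.
    right; exists (owner x), (shade x), (shade x); split.
    - by apply: linked0; apply: zone_shade.
    - by apply: reach_leq (reach_shade _); lia.
    - by left.
  have [Vy cy] := linked_target xy.
  have zy := reach_sym sE yz.
  have [sz|nz] := pselect (shell z).
    have [eyz uy] : cut (home y) = cut (home z) /\ near_up (2 * n) y.
      by apply: shell_adjacent; rewrite // cy (shell_true _ cz).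
    have cs b w : linked E (collar b) n w y -> linked E (collar b) n w z.
      move=> wy; have [cyb _] := linked_target wy.
      by apply: (linkedS wy yz); split; [rewrite -eyz|case: sz].
    case: IH => [[_ [b xby]]|[c [x0 [y0 [x0y0 xx0 yy0]]]]].
      by left; split=> //; exists b; apply: cs.
    right; exists c, x0, y0; split=> //; right; split=> //.
    case: yy0 => [[ny yy0 oy]|[_ [b [y1 [u1 oy1 y1y y1y0]]]]]; last first.
      by exists b, y1; split=> //; apply: cs.
    have u1 : near_up n y by apply: contrapT => nu; apply: ny.
    exists (cut (home y)), y; split=> //; first by apply: cs; apply: linked0.
    by rewrite -yy0 /shade; case: asboolP.
  have [sy|ny] := pselect (shell y).
    have [eyz uz] : cut (home z) = cut (home y) /\ near_up (2 * n) z.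
      by apply: shell_adjacent; rewrite // cz (shell_true _ cy).
    have uz1 : near_up n z by apply: contrapT => nu; apply: nz.
    have cs b w : linked E (collar b) n w y -> linked E (collar b) n w z.
      move=> wy; have [cyb _] := linked_target wy.
      by apply: (linkedS wy yz); split; [rewrite eyz|].
    case: IH => [[_ [b /cs xz]]|[c [x0 [y0 [x0y0 xx0 yy0]]]]].
      right; exists (owner z), (shade z), (shade z); split.
      - by apply: linked0; apply: zone_shade.
      - exact: (reach_trans (linked_collar xz) (reach_shade z)).
      - by left.
    case: yy0 => [[]//|[_ [b [y1 [u1 oy1 /cs y1z y1y0]]]]].
    have oz : owner z = c.
      rewrite -oy1 /owner; case: asboolP => // _; case: asboolP => // _.
      by have [-> _] := linked_target y1z; have [-> _] := linked_source y1z.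
    right; exists c, x0, (shade z); split=> //; last by left.
    apply: (linkedS x0y0); last by rewrite -oz; apply: zone_shade.
    apply: (@reach_leq _ _ (n + T + n)); first by move: tT; lia.
    apply: reach_trans (reach_shade _); apply: reach_trans (linked_collar y1z).
    by apply: reach_sym => //; rewrite -y1y0; case: (shadowP u1).
  case: IH => [[]//|[c [x0 [y0 [x0y0 xx0 yy0]]]]].
  case: yy0 => [[_ yy0 oy]|[]//].
  have oz : owner z = c by rewrite -(owner_eq yz).
  right; exists c, x0, (shade z); split=> //; last by left.
  apply: (linkedS x0y0); last by rewrite -oz; apply: zone_shade.
  rewrite -yy0; apply: (@reach_leq _ _ (n + n + n)); first by move: tT; lia.
  apply: reach_trans (reach_shade _); apply: reach_trans yz.
  by apply: reach_sym => //; apply: reach_shade.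
move=> /key[[_ [b /linked_collar]]|[c [x0 [y0 [/linked_core x0y0 xx0 yy0]]]]].
  by apply: reach_leq; rewrite /step_bound; lia.
apply: (reach_trans (reach_trans xx0 x0y0)); apply: reach_sym => //.
case: yy0 => [[_ <- _]|[_ [b [y1 [u1 _ /linked_collar y1y <-]]]]].
  by apply: reach_leq (reach_shade _); lia.
have [_ y1s] := shadowP u1; exact: (reach_trans (reach_sym sE y1y) y1s).
Qed.

End Step.

(** Induction on [N] for all [n], as the pieces are coloured at the larger scale [t]. That [D]
    depends only on [N] and [n] gives uniformity over all systems. *)
Lemma treelike_colouring (N n : nat) : exists D : nat,
  forall (V : Type) (A : eqType) (E : V -> V -> Prop) (V' : V -> Prop)
    (home : V -> seq A), treelike E V' home N ->
  exists c : V -> bool, forall x y k,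
    linked E (fun v => V' v /\ c v = k) n x y -> reach E D x y.
Proof.
elim: N n => [|N IH] n.
  exists 0 => V A E V' home G; exists (fun=> true) => x y k xy.
  have [Vx _] := linked_source xy.
  have [c cN _] := treelike_cover G (home x).
  by have := cN x (or_intror (conj Vx erefl)).
pose t := spread N.+1 (2 * n) n + 3 * n.
have [D' HD] := IH t; exists (step_bound N n t D') => V A E V' home G.
have /choice[col colP] : forall c, exists f : V -> bool, cut n E V' home c = c ->
    forall x y k,
      linked (subgraph E (kept n E V' home c))
        (fun v => piece n E V' home c v /\ f v = k) t x y ->
      reach (subgraph E (kept n E V' home c)) D' x y.
  move=> c; have [cc|nc] := pselect (cut n E V' home c = c); last by exists (fun=> true).
  by have [f Hf] := HD _ _ _ _ _ (treelike_piece G cc); exists f.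
have /choice[shadow shadowP] : forall v, exists w, near_up n E V' home n v ->
    up_bag E home (cut n E V' home (home v)) w /\ reach E n v w.
  move=> v; have [[w uw vw]|nv] := pselect (near_up n E V' home n v).
    by exists w.
  by exists v.
exists (colour n E V' home col shadow) => x y k.
exact: (linked_colour G colP (leqnn _) shadowP).
Qed.

Local Open Scope classical_set_scope.
Local Open Scope ring_scope.

(** * Finite systems *)

Section Cover.
Context {R : realType} (X : metricType R).
Implicit Types (x y : X) (A B : set X).

Lemma diameter_ge A x y : A x -> A y -> ((mdist x y)%:E <= diameter (@edist R X) A)%E.
Proof.
move=> Ax Ay; rewrite /diameter le_max; apply/orP; right.
by apply: ereal_sup_ubound; exists (x, y).
Qed.

Lemma mesh_diam (U : set (set X)) A (D : R) x y : (mesh (@edist R X) U <= D%:E)%E ->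
  U A -> A x -> A y -> mdist x y <= D.
Proof.
move=> UD UA Ax Ay; rewrite -lee_fin; apply: le_trans UD.
apply: le_trans (diameter_ge Ax Ay) _.
by apply: ereal_sup_ubound; exists A.
Qed.

(** The Lebesgue number is a supremum that need not be attained, hence the radius [r / 2]. *)
Lemma AN_cover n (K : R) : control_function (@edist R X) n (fun r => K * r) ->
  forall r : R, 0 < r -> exists U : 'I_n.+1 -> set (set X),
  [/\ forall x, exists i, exists2 A, U i A & forall y, mdist x y < r / 2 -> A y,
      forall i A x y, U i A -> A x -> A y -> mdist x y <= K * r &
      forall i A B x, U i A -> U i B -> A x -> B x -> A = B].
Proof.
move=> [_ H] r r0; have [U /= [covU meshU lebU disjU]] := H r r0.
exists U; split.
- move=> x; have : ((r / 2)%:E < lebesgue_number (@edist R X) (\bigcup_(i in setT) U i))%E.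
    by apply: lt_le_trans lebU; rewrite lte_fin; lra.
  move=> /ereal_sup_gt[_ [s [s0 /(_ x)[A [i _ UiA] sA]] <-]]; rewrite lte_fin => rs.
  exists i, A => // y xy; apply: sA; rewrite /eball /edist /= lte_fin.
  exact: lt_trans rs.
- move=> i A x y UA; apply: mesh_diam meshU _ => //; by exists i.
- by move=> i A B x UA UB Ax Bx; apply: (disjU i A B) => //; exists x.
Qed.

End Cover.

Section Finite.
Context {T : eqType}.

Lemma seq_argmax {R : realType} (g : T -> R) (P : T -> Prop) (s : seq T) x :
  x \in s -> P x ->
  exists y, [/\ y \in s, P y & forall z, z \in s -> P z -> g z <= g y].
Proof.
elim: s x => // a s IH x xs Px.
have [[y ys Py]|nP] := pselect (exists2 y, y \in s & P y); last first.
  exists x; split=> // z; move: xs; rewrite !inE.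
  case/orP=> [/eqP->|xs _]; last by case: nP; exists x.
  by case/orP=> [/eqP-> //|zs Pz]; case: nP; exists z.
have [w [ws Pw wmax]] := IH y ys Py.
have [[Pa aw]|na] := pselect (P a /\ g w <= g a).
  exists a; split=> //; first by rewrite inE eqxx.
  move=> z; rewrite inE => /orP[/eqP-> //|zs Pz].
  by apply: le_trans aw; apply: wmax.
exists w; split=> //; first by rewrite inE ws orbT.
move=> z; rewrite inE => /orP[/eqP-> Pa|]; last exact: wmax.
by apply: ltW; rewrite ltNge; apply/negP => aw; apply: na.
Qed.

Lemma seq_pos_lb {R : realType} (g : T -> R) (s : seq T) :
  exists2 e, 0 < e & forall x, x \in s -> 0 < g x -> e <= g x.
Proof.
elim: s => [|a s [e e0 es]]; first by exists 1.
have [ga|ga] := ltP 0 (g a); last first.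
  by exists e => // x; rewrite inE => /orP[/eqP-> /(le_lt_trans ga)|]; [rewrite ltxx|exact: es].
exists (Num.min e (g a)); first by rewrite lt_min e0.
move=> x; rewrite inE ge_min => /orP[/eqP->|xs gx]; first by rewrite lexx orbT.
by rewrite es.
Qed.

Lemma seq_maximal_disjoint {U : Type} (h : T -> set U) (P : T -> Prop) (s : seq T) :
  exists t : seq T, [/\ forall x, x \in t -> x \in s /\ P x,
    pairwise (fun x y => `[< h x `&` h y = set0 >]) t &
    forall x, x \in s -> P x -> h x !=set0 -> exists2 y, y \in t & h x `&` h y !=set0].
Proof.
elim: s => [|a s [t [ts tt tm]]]; first by exists [::].
have [Pa|nPa] := pselect (P a); last first.
  exists t; split=> // [x /ts[xs Px]|x]; first by rewrite inE xs orbT.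
  by rewrite inE => /orP[/eqP->//|]; exact: tm.
have [[y yt ay]|na] := pselect (exists2 y, y \in t & h a `&` h y !=set0).
  exists t; split=> // [x /ts[xs Px]|x]; first by rewrite inE xs orbT.
  by rewrite inE => /orP[/eqP-> _ _|]; [exists y|exact: tm].
exists (a :: t); split=> [x||x].
- by rewrite inE => /orP[/eqP->|/ts[xs]]; rewrite inE ?eqxx // xs orbT.
- rewrite /= tt andbT; apply/allP => y yt; apply/asboolP/eqP/negPn/negP => /set0P ay.
  by apply: na; exists y.
- rewrite inE => /orP[/eqP-> _ [p hp]|xs Px hx].
    by exists a; [rewrite inE eqxx|exists p].
  by have [y yt xy] := tm x xs Px hx; exists y => //; rewrite inE yt orbT.
Qed.

Lemma pairwise_disjoint_eq {U : Type} (h : T -> set U) (s : seq T) x y :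
  pairwise (fun x y => `[< h x `&` h y = set0 >]) s ->
  x \in s -> y \in s -> h x `&` h y !=set0 -> x = y.
Proof.
elim: s => //= a s IH /andP[/allP as0 ss]; rewrite !inE.
have disj z : z \in s -> ~ (h a `&` h z !=set0).
  by move=> /as0/asboolP -> [].
case/orP=> [/eqP->|xs] /orP[/eqP->|ys] xy //; last exact: IH.
- by case: (disj _ ys).
- by case: (disj _ xs); rewrite setIC.
Qed.

Lemma pairwise_disjoint_uniq {U : Type} (h : T -> set U) (s : seq T) :
  (forall x, x \in s -> h x !=set0) ->
  pairwise (fun x y => `[< h x `&` h y = set0 >]) s -> uniq s.
Proof.
elim: s => //= a s IH hs /andP[/allP as0 ss].
rewrite IH ?andbT => [|x xs|] //; last by apply: hs; rewrite inE xs orbT.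
apply/negP => /as0/asboolP; rewrite setIid => a0.
by have := hs a (mem_head _ _); rewrite a0 => -[].
Qed.

Lemma size_le_card (s : seq T) m : uniq s -> ([set` s] #<= `I_m)%card -> (size s <= m)%N.
Proof.
case: s => // a s us; rewrite -card_le_II; apply: card_le_trans.
have inj : {in `I_(size (a :: s)) &, injective (nth a (a :: s))}.
  by move=> i j; rewrite !inE => /= ? ? /eqP; rewrite nth_uniq // => /eqP.
rewrite -(card_le_eql (inj_card_eq inj)); apply: subset_card_le.
by move=> _ [i /= ilt <-]; exact: mem_nth.
Qed.

End Finite.

Definition inter {T : Type} (F : set (set T)) (A B : set T) :=
  [/\ F A, F B & A `&` B !=set0].

Lemma inter_sym {T : Type} (F : set (set T)) A B : inter F A B -> inter F B A.
Proof. by move=> [? ? ?]; split; rewrite // setIC. Qed.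

(** * Levels, cells and bags of a finite system *)

Section System.
Context {R : realType} (X : metricType R) (n : nat) (K : R) (f : R -> nat).
Hypothesis K1 : 1 < K.
Hypothesis coverK : control_function (@edist R X) n (fun r => K * r).
Context (r l : nat).
Hypothesis Kl : 4 * K < l%:R.

Context (S : set (set X)) (F : seq (set X)).
Hypothesis fillS : space_filling f S.
Hypothesis FS : forall A, A \in F -> S A.

Implicit Types (A B C U W : set X) (x y p q : X).

Local Notation meet := (inter [set` F]).
Local Notation reach_meet := (reach (inter [set` F])).

Definition size_of A : R := fine (diameter (@edist R X) A).

Lemma size_ge0 A : 0 <= size_of A.
Proof. by apply: fine_ge0; rewrite /diameter le_max lexx. Qed.

Lemma diameter_size A : A \in F -> diameter (@edist R X) A = (size_of A)%:E.
Proof.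
move=> /FS SA; rewrite fineK // ge0_fin_numE; first by case: fillS => /(_ _ SA).
by rewrite /diameter le_max lexx.
Qed.

Lemma size_dist A x y : A \in F -> A x -> A y -> mdist x y <= size_of A.
Proof. by move=> AF Ax Ay; rewrite -lee_fin -diameter_size //; exact: diameter_ge. Qed.

Lemma reach_in m A B : A \in F -> reach_meet m A B -> B \in F.
Proof.
move=> AF; elim: m B => [|m IH] B /=; first by move=> <-.
by move=> [/IH//|[C _ []]].
Qed.

Lemma reach_dist (a : R) m A B x y : A \in F ->
  (forall C, reach_meet m A C -> size_of C <= a) -> reach_meet m A B ->
  A x -> B y -> mdist x y <= m.+1%:R * a.
Proof.
move=> AF; elim: m B y => [|m IH] B y ha /=.
  move=> eAB Ax By; rewrite mul1r; apply: (le_trans _ (ha _ (erefl _))).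
  by apply: size_dist; rewrite // eAB.
have a0 : 0 <= a by exact: (le_trans (size_ge0 A) (ha _ (reach_refl _ _ _))).
have ha' C : reach_meet m A C -> size_of C <= a by move=> h; apply: ha; left.
have le : m.+1%:R * a <= m.+2%:R * a by rewrite ler_wpM2r // ler_nat.
move=> [h Ax By|[C rAC CB] Ax By]; first exact: le_trans (IH _ _ ha' h Ax By) le.
have [_ BF [z [Cz Bz]]] := CB.
apply: le_trans (metric_triangle _ z _) _.
rewrite -[m.+2]addn1 natrD mulrDl mul1r lerD //; first exact: IH ha' rAC _ _.
by apply: (le_trans (size_dist BF Bz By)); apply: ha; right; exists C.
Qed.

(** Walk towards [B] and stop at the first set of size at least [s]; each earlier set contributes at
    most [s]. *)
Lemma reach_big (s : R) m A B x : A \in F -> 0 <= s ->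
  reach_meet m A B -> s <= size_of B -> A x ->
  exists C y, [/\ reach_meet m A C, s <= size_of C, C y & mdist x y <= m%:R * s].
Proof.
move=> AF s0; elim: m A x AF => [|m IH] A x AF.
  by move=> /= -> sB Bx; exists B, x; rewrite mdistxx mul0r.
move=> AB sB Ax; have [sA|sA] := leP s (size_of A).
  exists A, x; split=> //; first exact: reach_refl.
  by rewrite mdistxx mulr_ge0.
have : reach_meet m.+1 B A by apply: reach_sym => //; exact: inter_sym.
move=> [h|[C BC CA]].
  have [C [y [rAC sC Cy xy]]] := IH _ _ AF (reach_sym (@inter_sym _ _) h) sB Ax.
  exists C, y; split=> //; first by left.
  by apply: le_trans xy _; rewrite ler_wpM2r // ler_nat.
have [CF _ [z [Cz Az]]] := CA.
have [D [y [CD sD Dy zy]]] := IH _ _ CF (reach_sym (@inter_sym _ _) BC) sB Cz.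
exists D, y; split=> //.
  by rewrite -add1n; apply: reach_trans CD; apply: reach1; exact: inter_sym.
apply: le_trans (metric_triangle _ z _) _.
rewrite -[m.+1]add1n natrD mulrDl mul1r lerD //.
by apply: le_trans (ltW sA); exact: size_dist.
Qed.

Variable (s0 : R).
Hypothesis s0_gt0 : 0 < s0.

Let lam : R := l%:R.
Definition scale k := s0 * lam ^+ k.
(** The factor 8 keeps [r]-paths from a set of level [k] within [radius k / 8], so a ball of radius
    [radius k / 4] at their end still fits into one of radius [radius k / 2] at their start. *)
Definition radius k := 8 * r.+1%:R * scale k.+1.

Lemma lam_gt : 4 * K < lam. Proof. exact: Kl. Qed.
Lemma scale_gt0 k : 0 < scale k.
Proof. by rewrite mulr_gt0 // exprn_gt0 //; move: lam_gt K1; lra. Qed.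
Lemma radius_gt0 k : 0 < radius k.
Proof. by rewrite mulr_gt0 ?scale_gt0. Qed.
Lemma scaleS k : scale k.+1 = scale k * lam.
Proof. by rewrite /scale exprSr mulrA. Qed.
Lemma scale_le j k : (j <= k)%N -> scale j <= scale k.
Proof.
move=> jk; rewrite ler_wpM2l ?(ltW s0_gt0) // ler_weXn2l //.
by move: lam_gt K1; lra.
Qed.
Lemma radius_le j k : (j <= k)%N -> radius j <= radius k.
Proof. by move=> jk; rewrite ler_wpM2l ?mulr_ge0 // scale_le. Qed.
(** The choice of [l] above [4 * K] makes cells of lower level smaller than the margin in
    [inner]. *)
Lemma radius_lt j k : (j < k)%N -> K * radius j < radius k / 4.
Proof.
move=> jk; have := radius_le jk; have := radius_gt0 j.
have -> : radius j.+1 = radius j * lam by rewrite /radius scaleS mulrA.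
move=> h1 h2; have : radius j * (4 * K) < radius j * lam by rewrite ltr_pM2l // lam_gt.
lra.
Qed.


Variable top : set X -> set X.
Hypothesis topP : forall A, A \in F ->
  reach_meet r A (top A) /\ forall B, reach_meet r A B -> size_of B <= size_of (top A).

Definition active A := A \in F /\ 0 < size_of (top A).

Variable lev : set X -> nat.
Hypothesis levP : forall A, active A ->
  scale (lev A) <= size_of (top A) < scale (lev A).+1.

Variable U : nat -> 'I_n.+1 -> set (set X).
Hypothesis U_diam : forall k i A x y, U k i A -> A x -> A y -> mdist x y <= K * radius k.
Hypothesis U_disj : forall k i A B x, U k i A -> U k i B -> A x -> B x -> A = B.

Variables (pt : set X -> X) (idx : set X -> 'I_n.+1) (cell : set X -> set X).
Hypothesis ptP : forall A, active A -> A (pt A).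
Hypothesis cellP : forall A, active A -> U (lev A) (idx A) (cell A) /\
  forall y, mdist (pt A) y < radius (lev A) / 2 -> cell A y.

Lemma active_in A : active A -> A \in F. Proof. by case. Qed.

Lemma reach_dist_lev m A B x y : active A -> (m <= r)%N -> reach_meet m A B ->
  A x -> B y -> mdist x y <= r.+1%:R * scale (lev A).+1.
Proof.
move=> actA mr AB Ax By; have [_ topA] := topP (active_in actA).
have /andP[_ /ltW tops] := levP actA.
apply: (le_trans (@reach_dist (size_of (top A)) _ _ _ _ _ (active_in actA) _ AB Ax By)).
  by move=> C rAC; apply: topA; apply: reach_leq rAC.
by apply: ler_pM => //; [exact: size_ge0|rewrite ler_nat].
Qed.

(** All sets within [r] steps have diameter 0, so two that meet are the same singleton. *)
Lemma inactive_isolated m A B : A \in F -> ~ active A -> (m <= r)%N ->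
  reach_meet m A B -> A = B.
Proof.
move=> AF nA; have [_ topA] := topP AF.
have topA0 : size_of (top A) <= 0 by rewrite leNgt; apply/negP => h; apply: nA.
elim: m B => [//|m IH] B mr /= [rAB|[C rAC AB]]; first exact: IH (ltnW mr) rAB.
have eC : A = C by exact: IH (ltnW mr) rAC.
rewrite -eC in AB.
have [_ BF [z [Az Bz]]] := AB.
have AA m' D x y : (m' <= r)%N -> reach_meet m' A D -> D x -> D y -> x = y.
  move=> m'r AD Dx Dy; apply: mdist_positivity; apply: le_anti; rewrite mdist_ge0 andbT.
  apply: le_trans topA0; apply: le_trans (topA D (reach_leq m'r AD)).
  by apply: size_dist => //; exact: reach_in AD.
have AAx := AA 0%N A _ _ (leq0n _) (erefl _).
have BBx := AA 1%N B _ _ (leq_ltn_trans (leq0n _) mr) (reach1 AB).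
apply/seteqP; split=> y => [Ay|By]; first by rewrite (AAx _ _ Ay Az).
by rewrite (BBx _ _ By Bz).
Qed.

Variables (i : 'I_n.+1) (L : nat).
Hypothesis levL : forall A, active A -> (lev A <= L)%N.

Definition coloured A := active A /\ idx A = i.
Definition inner k W x := forall y, mdist x y < radius k / 4 -> W y.

Lemma inner_in k W x : inner k W x -> W x.
Proof. by apply; rewrite mdistxx divr_gt0 // radius_gt0. Qed.

(* The parent of a cell is the lowest cell above it that it meets well inside;
   as cells of lower level are small, it is then contained in it. *)
Definition next k C : option (set X) :=
  if pselect (exists W, U k i W /\ exists2 x, C x & inner k W x) is left e
  then Some (projT1 (cid e)) else None.

Fixpoint chain m k C : seq (nat * set X) := if m is m'.+1 then
  if next k C is Some W then (k, W) :: chain m' k.+1 W else chain m' k.+1 C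
  else [::].

Definition node k W := (k, W) :: chain (L - k) k.+1 W.
Definition home A := node (lev A) (cell A).

Lemma sub_inner j k C W x : (j < k)%N -> U j i C -> C x -> inner k W x -> C `<=` W.
Proof.
move=> jk UC Cx Wx y Cy; apply: Wx; apply: le_lt_trans (radius_lt jk).
exact: U_diam UC Cx Cy.
Qed.

(** Every cell chosen while climbing contains [x]. At level [k] disjointness then forces the chosen
    cell to be [W], whatever the choice in [next]. *)
Lemma node_suffix k W j0 j C x : U k i W -> inner k W x -> (k <= L)%N ->
  (j0 < j)%N -> (j <= k)%N -> U j0 i C -> C x ->
  suffix (node k W) (chain (L.+1 - j) j C).
Proof.
move=> UW Wx kL; move e : (k - j)%N => d; elim: d j0 j C e => [|d IH] j0 j C e j0j jk UC Cx.
  have {}e : j = k by lia.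
  subst j; rewrite subSn //= /next; case: pselect => [h|[]]; last by exists W; split=> //; exists x.
  case: cid => W' /= [UW' [y Cy Wy]].
  have W'x : W' x := sub_inner j0j UC Cy Wy Cx.
  by rewrite -(U_disj UW UW' (inner_in Wx) W'x) suffix_refl.
have jL : (j <= L)%N by lia.
rewrite subSn //= /next; case: pselect => [h|_].
  case: cid => W' /= [UW' [y Cy Wy]]; rewrite suffix_cons_split -subSS.
  have W'x : W' x := sub_inner j0j UC Cy Wy Cx.
  by rewrite (IH j) ?orbT //; lia.
by rewrite -subSS (IH j0) //; lia.
Qed.

Lemma chain_suffix k W t j0 j C : suffix ((k, W) :: t) (chain (L.+1 - j) j C) ->
  (j0 < j)%N -> U j0 i C ->
  [/\ (j <= k)%N, C `<=` W, U k i W & t = chain (L - k) k.+1 W].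
Proof.
move e : (L.+1 - j)%N => d; elim: d j0 j C e => [|d IH] j0 j C e /=.
  by rewrite suffixs0.
have e' : (L.+1 - j.+1)%N = d by lia.
rewrite /next; case: pselect => [h|_]; last first.
  move=> /(IH j0 j.+1 _ e') h j0j UC; have [jk CW UW tE] := h (ltnW j0j) UC.
  by split=> //; lia.
case: cid => W' /= [UW' [y Cy Wy]] + j0j UC.
have CW' : C `<=` W' := sub_inner j0j UC Cy Wy.
rewrite suffix_cons_split => /orP[/eqP[-> -> ->]|].
  by split=> //; rewrite -e'; congr (chain _ _ _); lia.
move=> /(IH j j.+1 _ e') hs; have [jk W'W UW tE] := hs (ltnSn _) UW'.
by split=> //; [lia|exact: subset_trans CW' W'W].
Qed.

Lemma home_suffix A k W t : coloured A -> suffix ((k, W) :: t) (home A) ->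
  [/\ (lev A <= k)%N, cell A `<=` W, U k i W & (k, W) :: t = node k W].
Proof.
move=> [actA iA]; have [UA _] := cellP actA; rewrite iA in UA.
rewrite /home /node suffix_cons_split => /orP[/eqP[-> -> ->]|]; first by split.
rewrite -subSS => h; have [kA AW UW ->] := chain_suffix h (ltnSn _) UA.
by split=> //; exact: ltnW.
Qed.

Lemma step_suffix A B : coloured A -> coloured B -> (lev A <= lev B)%N ->
  reach_meet r A B -> suffix (home B) (home A).
Proof.
move=> [actA iA] [actB iB] AB rAB.
have [UA HA] := cellP actA; have [UB HB] := cellP actB; rewrite iA in UA; rewrite iB in UB.
have dAB : mdist (pt B) (pt A) <= radius (lev B) / 8.
  rewrite metric_sym; apply: (le_trans (reach_dist_lev actA (leqnn _) rAB (ptP actA) (ptP actB))).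
  have := radius_le AB; rewrite /radius; lra.
have inB : inner (lev B) (cell B) (pt A).
  move=> y Ay; apply: HB; apply: (le_lt_trans (metric_triangle _ (pt A) _)).
  have := radius_gt0 (lev B); lra.
have Apt : cell A (pt A) by apply: HA; rewrite mdistxx divr_gt0 // radius_gt0.
move: AB; rewrite leq_eqVlt => /orP[/eqP e|AB].
  rewrite /home -e in UB inB *; rewrite (U_disj UA UB Apt (inner_in inB)).
  exact: suffix_refl.
rewrite /home {2}/node suffix_cons_split -subSS.
by rewrite (@node_suffix _ _ (lev A) _ _ (pt A)) ?orbT // levL.
Qed.


Definition step A B := [/\ coloured A, coloured B & reach_meet r A B].
Definition bag0 := bag_at step coloured home.
(* Joining nearby vertices of a common bag turns the bounded sets covering the bag
   into cliques, without enlarging any bag. *)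
Definition link A B := step A B \/
  reach_meet (2 * r + 2) A B /\ exists b, bag0 b A /\ bag0 b B.

(* Vertices of the bag of a cell of level [k] are within [r] steps of a set of
   diameter at least [scale k] that meets a fixed ball of radius
   [crowd * scale k]. *)
Definition crowd : R := K * 8 * r.+1%:R * lam + r.+1%:R * lam + r%:R + 1.

Lemma bag0_coloured b z : bag0 b z -> coloured z.
Proof. by move=> [[x [[_ ? _]]]|[]]. Qed.

Lemma bag0_suffix b z : bag0 b z -> suffix (home z) b.
Proof. by move=> [[x []]//|[_ ->]]; exact: suffix_refl. Qed.

(** A vertex in the bag of a cell of level [k] has level at least [k], so its [top] has size at
    least [scale k] and [reach_big] applies. *)
Lemma bag0_witness k W t z : bag0 ((k, W) :: t) z -> exists x C q,
  [/\ U k i W /\ W x, reach_meet r z C, scale k <= size_of C, C q &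
      mdist x q <= (r.+1%:R * lam + r%:R) * scale k].
Proof.
move=> bz; have [actz iz] := bag0_coloured bz; have zF := active_in actz.
have [x [UW Wx xz kz]] : exists x, [/\ U k i W, W x,
    mdist x (pt z) <= r.+1%:R * scale k.+1 & (k <= lev z)%N].
  case: bz => [[x [[cx _ xz] bx]]|[_ [<- <- _]]].
    have [xk xW UW [et]] := home_suffix cx bx.
    rewrite suffix_cons_split => /orP[/eqP-> //|].
    rewrite et -subSS => h _; have [kz _ _ _] := chain_suffix h (ltnSn _) UW.
    have [actx ix] := cx; have [_ hx] := cellP actx.
    exists (pt x); split=> //; last exact: ltnW.
      by apply: xW; apply: hx; rewrite mdistxx divr_gt0 // radius_gt0.
    apply: (le_trans (reach_dist_lev actx (leqnn _) xz (ptP actx) (ptP actz))).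
    by rewrite ler_wpM2l // scale_le.
  have [Uz hz] := cellP actz; rewrite iz in Uz.
  exists (pt z); split=> //.
    by apply: hz; rewrite mdistxx divr_gt0 // radius_gt0.
  by rewrite mdistxx mulr_ge0 // ltW // scale_gt0.
have [ztop _] := topP zF; have /andP[ztops _] := levP actz.
have sz : scale k <= size_of (top z) by apply: le_trans ztops; exact: scale_le.
have [C [q [zC sC Cq zq]]] := reach_big zF (ltW (scale_gt0 k)) ztop sz (ptP actz).
exists x, C, q; split=> //; apply: (le_trans (metric_triangle _ (pt z) _)).
by rewrite mulrDl lerD // -mulrA [lam * _]mulrC -scaleS.
Qed.

(** Space-filling bounds a maximal disjoint family of large sets meeting the ball by [f crowd]. Each
    bag vertex is within [r] steps of a large set meeting a member; vertices sharing a member are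
    within [2 * r + 2] steps, hence linked. *)
Lemma bag0_cover b : clique_cover link (f crowd) (bag0 b).
Proof.
have [nb|ne] := pselect (forall z, ~ bag0 b z).
  by exists (fun=> 0%N) => [z|z z'] /nb.
have [z0 bz0] : exists z, bag0 b z.
  by apply: contrapT => h; apply: ne => z bz; apply: h; exists z.
case: b {ne} bz0 => [|[k W] t] bz0.
  by have := bag0_suffix bz0; rewrite suffixs0.
have [p [_ [_ [[UW Wp] _ _ _ _]]]] := bag0_witness bz0.
have sk0 := scale_gt0 k.
pose P C := scale k <= size_of C /\ C `&` ball p (crowd * scale k) !=set0.
have /choice[rep repP] : forall z, exists C, bag0 ((k, W) :: t) z ->
    [/\ reach_meet r z C, C \in F & P C].
  move=> z; have [bz|nbz] := pselect (bag0 ((k, W) :: t) z); last by exists set0.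
  have [x [C [q [[_ Wx] zC sC Cq xq]]]] := bag0_witness bz.
  exists C => _; split=> //.
    by apply: reach_in zC; apply: active_in; case: (bag0_coloured bz).
  split=> //; exists q; split=> //; rewrite ballEmdist /=.
  apply: (le_lt_trans (metric_triangle _ x _)).
  have := U_diam UW Wp Wx; rewrite /radius scaleS => h.
  apply: (le_lt_trans (lerD h xq)); rewrite /crowd.
  rewrite -subr_gt0; set Y := (Y in 0 < Y); suff -> : Y = scale k by [].
  by rewrite /Y; ring.
have [I [IF Idisj Imax]] := seq_maximal_disjoint (fun C : set X => C) P F.
have Ine C : C \in I -> C !=set0 by move=> /IF[_ [_ [q [Cq _]]]]; exists q.
have crowd0 : 0 < crowd.
  have := lam_gt; have : 0 <= r%:R :> R by []; have := K1.
  rewrite /crowd => K1' r0 lamK; have lam0 : 0 < lam by lra.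
  have : 0 <= K * 8 * r.+1%:R * lam by rewrite !mulr_ge0 // ltW //; lra.
  have : 0 <= r.+1%:R * lam by rewrite mulr_ge0 // ltW.
  lra.
have sizeI : (size I <= f crowd)%N.
  apply: size_le_card; first exact: pairwise_disjoint_uniq Idisj.
  have [_ /(_ (crowd * scale k) (scale k) p)] := fillS.
  rewrite mulfK ?gt_eqF // => /(_ (mulr_gt0 crowd0 sk0) sk0 [set` I]); apply.
  - by move=> C /IF[/FS].
  - by move=> C C' CI C'I; exact: pairwise_disjoint_eq Idisj CI C'I.
  - move=> C /= /IF[CF [sC CB]]; split=> //.
    by rewrite diameter_size // lee_fin.
have repI z : bag0 ((k, W) :: t) z -> has (fun C => `[< rep z `&` C !=set0 >]) I.
  move=> /repP[_ zF Pz]; have [] := Imax _ zF Pz.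
    by case: Pz => _ [q [zq _]]; exists q.
  by move=> C CI zC; apply/hasP; exists C => //; apply/asboolP.
exists (fun z => find (fun C => `[< rep z `&` C !=set0 >]) I) => [z bz|z z' bz bz' e].
  by apply: leq_trans sizeI; rewrite -has_find repI.
apply: reach1; right; split; last by exists ((k, W) :: t).
have := nth_find set0 (repI _ bz); have := nth_find set0 (repI _ bz').
rewrite -e; set C := nth _ _ _ => /asboolP z'C /asboolP zC.
have CI : C \in I by apply: mem_nth; rewrite -has_find repI.
have [CF _] := IF _ CI.
have [zrep zF _] := repP _ bz; have [z'rep z'F _] := repP _ bz'.
have -> : (2 * r + 2 = r + 1 + 1 + r)%N by lia.
apply: reach_trans; last by apply: reach_sym z'rep; exact: inter_sym.
apply: (@reach_trans _ _ _ _ _ C).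
  by apply: reach_trans zrep _; apply: reach1.
by apply: reach1; split=> //; rewrite setIC.
Qed.

Lemma step_sym A B : step A B -> step B A.
Proof. by move=> [? ? ?]; split=> //; apply: reach_sym => //; exact: inter_sym. Qed.

Lemma treelike_link : treelike link coloured home (f crowd).
Proof.
split.
- move=> A B [/step_sym|[AB [b [bA bB]]]]; [by left|right; split; last by exists b].
  by apply: reach_sym AB; exact: inter_sym.
- move=> A B [AB|[_ [b [/bag0_suffix bA /bag0_suffix bB]]]]; last exact: (suffix_comparable bB bA).
  have [le|/ltnW le] := leqP (lev A) (lev B).
    by have [cA cB rAB] := AB; rewrite step_suffix.
  by have [cB cA rAB] := step_sym AB; rewrite [X in _ || X]step_suffix ?orbT.
- by move=> A B [[]//|[_ [b [_ /bag0_coloured]]]].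
- move=> b; have [c cN cE] := bag0_cover b.
  suff sub z : bag_at link coloured home b z -> bag0 b z.
    by exists c => [z /sub/cN//|z z' /sub bz /sub]; exact: cE.
  (* A link inside the bag of [b1] that crosses [b] forces [b1] below [b]; its upper end is then
     already in the bag of [b] through a step. *)
  move=> [[x [[xz|[_ [b1 [b1x b1z]]]] bx zb nzb]]|bz]; last by right.
    by left; exists x.
  have bb1 := suffix_trans bx (bag0_suffix b1x).
  case: b1z => [[x' [x'z b1x' _ _]]|[_ ez]].
    by left; exists x'; split=> //; exact: (suffix_trans bb1 b1x').
  by case: nzb; apply: suffix_anti zb _; rewrite ez.
Qed.


Lemma class_colouring D :
  (forall (V : Type) (A : eqType) (E : V -> V -> Prop) (V' : V -> Prop)
    (hm : V -> seq A), treelike E V' hm (f crowd) ->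
    exists c : V -> bool, forall (u v : V) k,
      linked E (fun w => V' w /\ c w = k) 1 u v -> reach E D u v) ->
  exists c : set X -> bool, forall A B k,
    linked meet (fun A => coloured A /\ c A = k) r A B ->
    reach_meet (D * (2 * r + 2)) A B.
Proof.
move=> HD; have [c cP] := HD _ _ _ _ _ treelike_link.
exists c => A B k AB; apply: (@reach_expand _ link).
  move=> C C' [[_ _]|[]//]; apply: reach_leq; lia.
apply: (cP A B k); apply: linked_map AB => [//|C C' [cC _] [cC' _] CC'].
by apply: reach1; left.
Qed.

End System.

Lemma inter_nonempty {T : Type} (F : set (set T)) m A B :
  reach (inter F) m A B -> B !=set0 -> A !=set0.
Proof.
elim: m B => [|m IH] B /=; first by move=> ->.
by move=> [/IH//|[C /IH h [_ _ [x [Cx _]]]] _]; apply: h; exists x.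
Qed.

Lemma size_of_nonempty {R : realType} (X : metricType R) (A : set X) :
  0 < size_of A -> A !=set0.
Proof.
move=> A0; apply/set0P/eqP => e; move: A0.
by rewrite e /size_of /diameter set0X image_set0 ereal_sup0 maxeNy ltxx.
Qed.

(** * Colouring a finite system *)

Section FiniteColouring.
Context {R : realType} (X : metricType R) (n : nat) (K : R) (f : R -> nat).
Hypothesis K1 : 1 < K.
Hypothesis coverK : control_function (@edist R X) n (fun r => K * r).

Lemma finite_colouring (r : nat) : exists D : nat,
  forall (S : set (set X)) (F : seq (set X)), space_filling f S ->
  (forall A, A \in F -> S A) ->
  exists c : set X -> bool * 'I_n.+1, forall A B k,
    linked (inter [set` F]) (fun A => A \in F /\ c A = k) r A B ->
    reach (inter [set` F]) D A B.
Proof.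
pose l := (Num.truncn (4 * K)).+1.
have Kl : 4 * K < l%:R by exact: truncnS_gt.
(* Scale 1 suffices, since an [r]-step is a single edge of [link]. *)
have [D HD] := treelike_colouring (f (crowd K r l)) 1.
exists (D * (2 * r + 2))%N => S F fillS FS.
have [s0 s0_gt0 s0P] := seq_pos_lb (@size_of R X) F.
have /choice[top topP] : forall A, exists B, A \in F ->
    reach (inter [set` F]) r A B /\
    forall C, reach (inter [set` F]) r A C -> size_of C <= size_of B.
  move=> A; have [AF|nA] := boolP (A \in F); last by exists A.
  have [B [BF AB Bmax]] := @seq_argmax _ R (@size_of R X) (reach (inter [set` F]) r A) F A AF
    (reach_refl _ _ _).
  by exists B => _; split=> // C rAC; apply: Bmax => //; exact: reach_in rAC.
have act_nonempty A : active F top A -> A !=set0.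
  move=> [AF topA0]; have [rA _] := topP A AF.
  exact: inter_nonempty rA (size_of_nonempty topA0).
have inactive A k (c : set X -> bool * 'I_n.+1) B : ~ active F top A ->
    linked (inter [set` F]) (fun A => A \in F /\ c A = k) r A B -> A = B.
  move=> nA AB; have [AF _] := linked_source AB.
  elim: AB => // {}B C _ <- rAC _.
  exact: (inactive_isolated fillS FS topP AF nA (leqnn _) rAC).
have [[A0 actA0]|none] := pselect (exists A, active F top A); last first.
  exists (fun=> (true, ord0)) => A B k AB.
  rewrite (inactive _ _ _ _ _ AB); first exact: reach_refl.
  by move=> actA; apply: none; exists A.
have [x0 _] := act_nonempty _ actA0.
have /choice[lev levP] : forall A, exists k, active F top A ->
    scale l s0 k <= size_of (top A) < scale l s0 k.+1.
  move=> A; have [actA|] := pselect (active F top A); last by exists 0%N.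
  have [AF topA0] := actA; have [rA _] := topP A AF.
  have topF : top A \in F by exact: reach_in rA.
  have ex : exists k, size_of (top A) < scale l s0 k.+1.
    set m := (Num.truncn (size_of (top A) / s0)).+1; exists m.
    rewrite /scale mulrC -ltr_pdivrMr //; apply: (lt_le_trans (truncnS_gt _)).
    have l1 : (1 < l)%N by rewrite -(ltr_nat R); move: K1 Kl; lra.
    by rewrite -natrX ler_nat (leq_trans (ltnW (ltn_expl m l1))) // leq_exp2l.
  exists (ex_minn ex) => _; case: ex_minnP => k -> kmin; rewrite andbT.
  (* Level 0 is legitimate because [s0] is below every positive size in [F]. *)
  case: k kmin => [_|k kmin]; first by rewrite /scale expr0 mulr1 s0P.
  by rewrite leNgt; apply/negP => /kmin; rewrite ltnn.
have /choice[U UP] : forall k, exists U : 'I_n.+1 -> set (set X),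
  [/\ forall x, exists i, exists2 A, U i A & forall y, mdist x y < radius r l s0 k / 2 -> A y,
      forall i A x y, U i A -> A x -> A y -> mdist x y <= K * radius r l s0 k &
      forall i A B x, U i A -> U i B -> A x -> B x -> A = B].
  by move=> k; exact: (AN_cover coverK (radius_gt0 K1 r Kl s0_gt0 k)).
have /choice[pt ptP] : forall A, exists x, active F top A -> A x.
  move=> A; have [actA|nA] := pselect (active F top A); last by exists x0.
  by have [x Ax] := act_nonempty A actA; exists x.
have /choice[cl clP] : forall A, exists iC : 'I_n.+1 * set X, active F top A ->
    U (lev A) iC.1 iC.2 /\
    forall y, mdist (pt A) y < radius r l s0 (lev A) / 2 -> iC.2 y.
  move=> A; have [/(_ (pt A))[i [C UC HC]] _ _] := UP (lev A).
  by exists (i, C).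
have levL A : active F top A -> (lev A <= \max_(B <- F) lev B)%N.
  by move=> [AF _]; exact: leq_bigmax_seq.
have /choice[c cP] : forall i, exists c : set X -> bool, forall A B k,
    linked (inter [set` F]) (fun A => coloured F top (fun A => (cl A).1) i A /\ c A = k) r A B ->
    reach (inter [set` F]) (D * (2 * r + 2)) A B.
  move=> i; apply: (class_colouring K1 Kl fillS FS s0_gt0 topP levP _ _ ptP clP i levL HD).
  - by move=> k j; have [_ Udiam _] := UP k; exact: Udiam.
  - by move=> k j; have [_ _ Udisj] := UP k; exact: Udisj.
(* Recording the index keeps a monochromatic chain in one class; it is either constant or active
   throughout. *)
exists (fun A => (c (cl A).1 A, (cl A).1)) => A B [k i] AB.
have [actA|nA] := pselect (active F top A); last first.
  by rewrite (inactive _ _ _ _ nA AB); exact: reach_refl.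
apply: (cP i _ _ k); move: AB; elim=> [[_ [ck ci]]|{}B C AB IH BC [CF [ck ci]]].
  by apply: linked0; split; [split|rewrite -ci].
have [actB _] := (linked_target IH).1.
apply: (linkedS IH BC); split; [split=> //|by rewrite -ci].
apply: contrapT => nC; apply: (nC).
rewrite (inactive_isolated fillS FS topP CF nC (leqnn _) (reach_sym (@inter_sym _ _) BC)).
exact: actB.
Qed.

End FiniteColouring.

(** * Compactness and the covers *)

Section Compactness.
Context {T : Type} {C : finType} (S : set (set T)) (r D : nat).

Definition bounded_colouring (F : set (set T)) (c : set T -> C) :=
  forall A B k, linked (inter F) (fun A => F A /\ c A = k) r A B ->
  reach (inter F) D A B.

(** Take the limit of the finite colourings along an ultrafilter containing all tails of finite
    subfamilies. A chain involves finitely many sets, so it is monochromatic in almost every finite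
    colouring. *)
Lemma colouring_compactness :
  (forall F : seq (set T), (forall A, A \in F -> S A) ->
     exists c, bounded_colouring [set` F] c) ->
  exists c, bounded_colouring S c.
Proof.
move=> H; have [c0 _] := H [::] (fun A => ltac:(by [])).
have /choice[col colP] : forall F : seq (set T), exists c, (forall A, A \in F -> S A) ->
    bounded_colouring [set` F] c.
  move=> F; have [FS|nF] := pselect (forall A, A \in F -> S A).
    by have [c cP] := H F FS; exists c.
  by exists c0.
pose above (F : seq (set T)) := [set G : seq (set T) | {subset F <= G} /\ forall A, A \in G -> S A].
pose tails : set_system (seq (set T)) :=
  [set P | exists2 F, (forall A, A \in F -> S A) & above F `<=` P].
have tailsF : ProperFilter tails.
  apply: Build_ProperFilter_ex => [P [F FS FP]|].
    by exists F; apply: FP; split.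
  split.
  - by exists [::].
  - move=> P Q [F FS FP] [G GS GQ]; exists (F ++ G) => [A|K [FGK KS]].
      by rewrite mem_cat => /orP[/FS|/GS].
    split; [apply: FP|apply: GQ]; split=> // A h; apply: FGK; rewrite mem_cat h //.
    by rewrite orbT.
  - by move=> P Q PQ [F FS FP]; exists F => //; exact: subset_trans PQ.
have [U [UU tailsU]] := ultraFilterLemma tailsF.
have UF : ProperFilter U by exact: ultra_proper.
have /choice[c cU] : forall A, exists k, U [set F | col F A = k].
  move=> A; apply: contrapT => nk.
  have : U (fun F => forall k, col F A <> k).
    apply: filter_forall => k; have [h|//] := in_ultra_setVsetC [set F | col F A = k] UU.
    by case: nk; exists k.
  by move=> /filter_ex[F /(_ (col F A))].
have US : U [set G : seq (set T) | forall A, A \in G -> S A].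
  by apply: tailsU; exists [::] => // G [].
have memU A : S A -> U [set G : seq (set T) | A \in G].
  move=> SA; apply: tailsU; exists [:: A] => [B|G [sub _]].
    by rewrite inE => /eqP->.
  by apply: sub; rewrite inE.
have reachU m A B : reach (inter S) m A B -> U [set G : seq (set T) | reach (inter [set` G]) m A B].
  elim: m B => [|m IH] B /=; first by move=> ->; apply: filterS filterT.
  case=> [/IH|[K /IH AK [/memU KU /memU BU KB]]].
    by apply: filterS => G; left.
  by apply: filterS3 AK KU BU => G AK KG BG; right; exists K.
exists c => A B k AB.
have : U [set G : seq (set T) | linked (inter [set` G]) (fun A => [set` G] A /\ col G A = k) r A B].
  elim: AB => [[/memU AU cA]|{}B K _ IH /reachU BK [/memU KU cK]].
    have := cU A; rewrite cA; apply: filterS2 AU => G AG cG; exact: linked0.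
  have := cU K; rewrite cK => cKU; apply: filterS3 (filterI IH BK) KU cKU.
  move=> G [IHG BKG] KG cG; exact: (linkedS IHG BKG).
move=> /(filterI US)/filter_ex[G [GS /(colP G GS)]].
by apply: reach_sub => K K' [/GS ? /GS ? ?].
Qed.

End Compactness.

(** * From colourings to covers of the intersection graph *)

Section Graph.
Context {R : realType} {T : Type} (S : set (set T)).
Local Notation G := (intersection_graph S).
Implicit Types u v w : G.

Lemma path_reach u p : path (@edge G) u p ->
  reach (inter S) (size p) (set_val u) (set_val (last u p)).
Proof.
elim/last_ind: p => [//|p v IH]; rewrite rcons_path last_rcons size_rcons.
move=> /andP[/IH up /asboolP[_ lv]]; right; exists (set_val (last u p)) => //.
by split=> //; exact: set_valP.
Qed.

Lemma graph_dist_le m u v : reach (inter S) m (set_val u) (set_val v) ->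
  (@graph_dist R G u v <= m%:R%:E)%E.
Proof.
move=> uv; suff [p [pm pu pv]] : exists p : seq G,
    [/\ (size p <= m)%N, path (@edge G) u p & last u p = v].
  apply: (@le_trans _ _ (size p)%:R%:E); last by rewrite lee_fin ler_nat.
  by apply: ereal_inf_lbound; exists p.
elim: m v uv => [|m IH] v /=.
  by move=> /val_inj <-; exists [::].
case=> [/IH[p [pm pu pv]]|[K uK [SK Sv Kv]]]; first by exists p; rewrite leqW.
pose w : G := SigSub (mem_set SK).
have [p [pm pu pw]] := IH w uK.
(* A nonempty set meets itself, whereas edges join distinct sets. *)
have [wv|wv] := pselect (w = v); first by exists p; rewrite leqW // -wv.
exists (rcons p v); rewrite size_rcons rcons_path last_rcons pu /=; split=> //.
by rewrite pw; apply/asboolP; split.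
Qed.

Lemma graph_dist_lt (x : R) u v : (@graph_dist R G u v < x%:E)%E ->
  exists2 m, m%:R < x & reach (inter S) m (set_val u) (set_val v).
Proof.
move=> /ereal_inf_lt[_ [p [pu pv] <-]]; rewrite lte_fin => px.
by exists (size p) => //; rewrite -pv; exact: path_reach.
Qed.

End Graph.

Section FromColouring.
Context {R : realType} {T : Type} {C : finType} (S : set (set T)) (rho D : nat).
Variable c : set T -> C.
Hypothesis cP : bounded_colouring (2 * rho).+1 D S c.
Local Notation G := (intersection_graph S).
Implicit Types u v w : G.

(** Thickening a monochromatic component by [rho] secures the Lebesgue number; steps longer than
    [2 * rho] keep distinct thickened components disjoint. *)
Definition component k v : set G := [set w | exists2 B,
  linked (inter S) (fun A => S A /\ c A = k) (2 * rho).+1 (set_val v) B &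
  reach (inter S) rho B (set_val w)].

Lemma component_self v : component (c (set_val v)) v v.
Proof.
exists (set_val v); last exact: reach_refl.
by apply: linked0; split=> //; exact: set_valP.
Qed.

Lemma component_eq k v w u : component k v u -> component k w u ->
  component k v = component k w.
Proof.
suff sub x y : component k x u -> component k y u -> component k x `<=` component k y.
  by move=> vu wu; apply/seteqP; split; apply: sub.
move=> [A xA Au] [B yB Bu] z [K xK Kz]; exists K => //.
have AK := linked_trans (linked_sym (@inter_sym _ _) xA) xK.
apply: (linked_trans _ AK).
apply: (linkedS yB _ (linked_target xA)).
apply: (@reach_leq _ _ (rho + rho)); first by lia.
exact: (reach_trans Bu (reach_sym (@inter_sym _ _) Au)).
Qed.

Lemma component_dist k v x y : component k v x -> component k v y ->
  (@graph_dist R G x y <= (rho + D + rho)%:R%:E)%E.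
Proof.
move=> [A vA Ax] [B vB By]; apply: graph_dist_le; apply: (reach_trans _ By).
apply: (reach_trans (reach_sym (@inter_sym _ _) Ax)).
exact: (cP (linked_trans (linked_sym (@inter_sym _ _) vA) vB)).
Qed.

Lemma colouring_cover m (e : 'I_m.+1 -> C) (x : R) : 0 < x -> x <= rho%:R ->
  (forall k, exists i, e i = k) ->
  exists U : 'I_m.+1 -> set (set G), let W := \bigcup_(i in [set: 'I_m.+1]) U i in
  [/\ cover W id = [set: G], (mesh (@graph_dist R G) W <= (rho + D + rho)%:R%:E)%E,
      (x%:E <= lebesgue_number (@graph_dist R G) W)%E &
      forall i, trivIset (U i) id].
Proof.
move=> x0 xrho e_surj.
pose U i := [set A | exists v, A = component (e i) v]; exists U => W.
have WP v : W (component (c (set_val v)) v).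
  by have [i ei] := e_surj (c (set_val v)); exists i => //; exists v; rewrite ei.
split.
- apply/seteqP; split=> // v _; exists (component (c (set_val v)) v) => //.
  exact: component_self.
- apply: ge_ereal_sup => _ [_ [i _ [v ->]] <-].
  rewrite /diameter ge_max lee_fin ler0n /=.
  by apply: ge_ereal_sup => _ [[y z] [/= vy vz] <-]; exact: component_dist vy vz.
- apply: ereal_sup_ubound; exists x => //; split=> [|v]; first exact: ltW.
  exists (component (c (set_val v)) v) => // w /graph_dist_lt[d dx vw].
  exists (set_val v); first by apply: linked0; split=> //; exact: set_valP.
  by apply: reach_leq vw; rewrite -(ler_nat R); apply: (le_trans _ xrho); exact: ltW.
- move=> i A B [v ->] [w ->] [u [vu wu]]; exact: component_eq vu wu.
Qed.

End FromColouring.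

Theorem theorem2 (R : realType) (X : metricType R) (n : nat)
    (hX : AN_dim X n) (f : R -> nat) :
  asdim_le R (space_filling_graphs X f) (2 * n + 1)%N.
Proof.
have [[K K1 coverK] _] := hX.
have /choice[D DP] := finite_colouring f K1 coverK.
pose rho (x : R) := (Num.truncn x).+1.
exists (fun x => (rho x + D (2 * rho x).+1 + rho x)%:R) => _ [S fillS ->].
split=> [x _|x x0]; first exact: ler0n.
have [c cP] : exists c : set X -> bool * 'I_n.+1,
    bounded_colouring (2 * rho x).+1 (D (2 * rho x).+1) S c.
  by apply: colouring_compactness => F FS; exact: DP fillS FS.
have card_col : (2 * n + 1).+1 = #|{: bool * 'I_n.+1}|.
  by rewrite card_prod card_bool card_ord; lia.
apply: (colouring_cover cP (e := fun i => enum_val (cast_ord card_col i))) => //.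
  by apply: ltW; exact: truncnS_gt.
move=> k; exists (cast_ord (esym card_col) (enum_rank k)).
by rewrite cast_ordKV enum_rankK.
Qed.
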